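(* Let $\delta\ge 0$ and let $(X,d)$ be a proper, geodesic $\delta$-hyperbolic space with $\partial X\neq\emptyset$, and let $f\colon X\to\mathbb{R}$ be an $L$-Lipschitz convex function for some $L>0$. Assume that $\alpha:=-\inf_{v\in\partial X}\partial_\infty f(v)>0$. Let $\tau>0$. Then the following hold. (i) There exists a unique element $v_*\in\partial X$ satisfying $\partial_\infty f(v_* )<0$. (ii) For any $x_0\in X$ and any sequence $(x_k)_{k\in\mathbb{N}}$ in $X$ satisfying $x_k\in\mathsf{J}^f_\tau(x_{k-1})$ for all $k\in\mathbb{N}=\{1,2,\dots\}$ (a discrete-time gradient curve), $(x_k)_{k\in\mathbb{N}}$ converges to $v_*\in\partial X$ in $\overline{X}=X\sqcup\partial X$. (iii) Moreover, for $x_0$ and $(x_k)_{k\in\mathbb{N}}$ as in (ii), letting $\xi\colon[0,\infty)\to X$ be a ray representing $v_*$ with $\xi(0)=x_0$, we have $$\bigl(\xi(t)\,|\,x_k\bigr)_{x_0}\ \ge\ k\sqrt{\tau}\,\biggl\{\biggl(\frac{\alpha^2}{4L}+\frac{\alpha^4}{16L^3}\biggr)\sqrt{\tau}-2\sqrt{2L\delta}\biggr\}$$ for all $k\in\mathbb{N}$ and $t>0$ satisfying $f(\xi(t))\le f(x_k)$.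
   Context: Let $(X,d)$ be a metric space. It is proper if every bounded closed set is compact. It is geodesic if any $x,y\in X$ are joined by a (minimal) geodesic, i.e. a map $\gamma\colon[0,1]\to X$ with $\gamma(0)=x$, $\gamma(1)=y$ and $d(\gamma(s),\gamma(t))=|s-t|d(x,y)$ for all $s,t\in[0,1]$. The Gromov product is $(x|y)_p:=\frac12\{d(p,x)+d(p,y)-d(x,y)\}$. For $\delta\ge0$, $(X,d)$ is $\delta$-hyperbolic if $(x|z)_p\ge\min\{(x|y)_p,(y|z)_p\}-\delta$ for all $p,x,y,z\in X$. $f$ is $L$-Lipschitz if $|f(x)-f(y)|\le L\,d(x,y)$ for all $x,y\in X$. $f$ is (weakly, geodesically) convex if for any $x,y\in X$ there is a geodesic $\gamma\colon[0,1]\to X$ from $x$ to $y$ with $f(\gamma(s))\le(1-s)f(x)+sf(y)$ for all $s\in[0,1]$. A ray is a map $\xi\colon[0,\infty)\to X$ with $d(\xi(s),\xi(t))=|s-t|$ for all $s,t\ge0$. Two rays $\xi,\zeta$ are asymptotic if $\sup_{t\ge0}d(\xi(t),\zeta(t))<\infty$. This is an equivalence relation; $\partial X$ (the Gromov boundary) is the set of equivalence classes, $\xi(\infty)\in\partial X$ is the class of $\xi$, and $\xi$ is said to represent $\xi(\infty)$. Topology of $\overline{X}:=X\sqcup\partial X$ ($X$ proper, geodesic, $\delta$-hyperbolic): fix $p\in X$. A generalized ray from $p$ is either a ray $\xi$ with $\xi(0)=p$ (with $\xi(\infty)\in\partial X$ its class), or a unit speed geodesic $\xi\colon[0,l]\to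 X$ with $\xi(0)=p$, extended by $\xi(t):=\xi(l)$ for $t>l$, with $\xi(\infty):=\xi(l)\in X$. Generalized rays $\xi,\zeta$ from $p$ are equivalent if $\xi(\infty)=\zeta(\infty)$, and $\overline{X}$ is identified with the set of equivalence classes. Generalized rays $\xi_i$ converge to a generalized ray $\xi$ if $\xi_i\to\xi$ uniformly on each bounded interval of $[0,\infty)$. A sequence $(y_i)$ in $\overline{X}$ converges to $y\in\overline{X}$ if there are generalized rays $\xi_i$ from $p$ with $\xi_i(\infty)=y_i$ such that every subsequence of $(\xi_i)$ has a further subsequence converging to a generalized ray $\xi$ with $\xi(\infty)=y$. (This is independent of $p$.) For an $L$-Lipschitz convex function $f$ on a proper, geodesic $\delta$-hyperbolic space and $v\in\partial X$, the asymptotic slope is $\partial_\infty f(v):=\lim_{t\to\infty}f(\xi(t))/t\in(-\infty,\infty]$, where $\xi$ is a ray representing $v$ (the limit exists and does not depend on the choice of $\xi$). For $\tau>0$ and $x\in X$, the proximal (resolvent) operator is the set $\mathsf{J}^f_\tau(x):=\operatorname{arg\,min}_{y\in X}\bigl\{f(y)+\frac{d^2(x,y)}{2\tau}\bigr\}$ of all minimizers (it is nonempty when $X$ is proper and $f$ is Lipschitz). *)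

(* Defs.v *)
From HB Require Import structures.
From mathcomp Require Import all_boot all_order all_algebra generic_quotient.
From mathcomp Require Import all_classical all_reals all_analysis.

Set Implicit Arguments.
Unset Strict Implicit.
Unset Printing Implicit Defensive.

Import Order.TTheory GRing.Theory Num.Theory.
Import numFieldNormedType.Exports.

Local Open Scope classical_set_scope.
Local Open Scope ring_scope.
Local Open Scope quotient_scope.

Section MetricSpaces.
Context {R : realType} (X : metricType R).

Definition metric_bounded (A : set X) : Prop :=
  exists M : R, forall x y : X, A x -> A y -> mdist x y <= M.

Definition proper_space : Prop :=
  forall A : set X, metric_bounded A -> closed A -> compact A.

(* Only the restriction of gamma to [0, 1] matters. *)
Definition is_geodesic (x y : X) (gamma : R -> X) : Prop :=
  [/\ gamma 0 = x, gamma 1 = y &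
      forall s t : R, 0 <= s <= 1 -> 0 <= t <= 1 ->
        mdist (gamma s) (gamma t) = `|s - t| * mdist x y].

Definition geodesic_space : Prop :=
  forall x y : X, exists gamma : R -> X, is_geodesic x y gamma.

(* gromov_product p x y is (x|y)_p. *)
Definition gromov_product (p x y : X) : R :=
  2^-1 * (mdist p x + mdist p y - mdist x y).

Definition gromov_hyperbolic (delta : R) : Prop :=
  forall p x y z : X,
    Num.min (gromov_product p x y) (gromov_product p y z) - delta
      <= gromov_product p x z.

Definition lipschitz_fun (L : R) (f : X -> R) : Prop :=
  forall x y : X, `|f x - f y| <= L * mdist x y.

Definition weakly_convex (f : X -> R) : Prop :=
  forall x y : X, exists2 gamma : R -> X, is_geodesic x y gamma &
    forall s : R, 0 <= s <= 1 -> f (gamma s) <= (1 - s) * f x + s * f y.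

Definition proximal (f : X -> R) (tau : R) (x : X) : set X :=
  [set y | forall z : X, f y + mdist x y ^+ 2 / (2 * tau)
                      <= f z + mdist x z ^+ 2 / (2 * tau)].

Definition discrete_gradient_curve (f : X -> R) (tau : R) (x0 : X)
    (x : nat -> X) : Prop :=
  x 0%N = x0 /\ forall k : nat, (0 < k)%N -> proximal f tau (x k.-1) (x k).

(* The values of a ray at negative times are irrelevant: they are ignored by
   [asymptotic], so they do not affect the boundary point of the ray. *)
Record ray : Type := Ray {
  ray_fun :> R -> X ;
  ray_isometry : forall s t : R, 0 <= s -> 0 <= t ->
    mdist (ray_fun s) (ray_fun t) = `|s - t| }.

HB.instance Definition _ := gen_eqMixin ray.
HB.instance Definition _ := gen_choiceMixin ray.

Definition asymptotic (xi zeta : ray) : bool :=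
  `[< exists M : R, forall t : R, 0 <= t -> mdist (xi t) (zeta t) <= M >].

Lemma asymptotic_refl : reflexive asymptotic.
Proof. by move=> xi; apply/asboolP; exists 0 => t _; rewrite mdistxx. Qed.

Lemma asymptotic_sym : symmetric asymptotic.
Proof.
by move=> xi zeta; apply/asboolP/asboolP => -[M hM]; exists M => t t0;
  rewrite metric_sym hM.
Qed.

Lemma asymptotic_trans : transitive asymptotic.
Proof.
move=> zeta xi eta /asboolP[M hM] /asboolP[N hN]; apply/asboolP.
exists (M + N) => t t0; apply: (le_trans (metric_triangle _ (zeta t) _)).
by rewrite lerD ?hM ?hN.
Qed.

Canonical asymptotic_equiv :=
  EquivRel asymptotic asymptotic_refl asymptotic_sym asymptotic_trans.

Definition boundary : Type := {eq_quot asymptotic_equiv}.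

Definition ray_end (xi : ray) : boundary := \pi_({eq_quot asymptotic_equiv}) xi.

(* The representative [repr v] is an arbitrary one: for a Lipschitz weakly
   convex f on a hyperbolic space the limit exists along every ray and depends
   only on its class. *)
Definition asymptotic_slope (f : X -> R) (v : boundary) : \bar R :=
  let xi : ray := repr (v : {eq_quot asymptotic_equiv}) in
  lim ((f (xi t) / t)%:E @[t --> +oo%R]).

(* For f L-Lipschitz every slope lies in [-L, L], so this is a finite number as
   soon as the boundary is nonempty. *)
Definition descent_rate (f : X -> R) : \bar R :=
  (- ereal_inf (range (asymptotic_slope f)))%E.

Definition bordification : Type := (X + boundary)%type.

(* generalized_ray p xi y: xi is a generalized ray from p and xi(oo) = y. *)
Definition generalized_ray (p : X) (xi : R -> X) (y : bordification) : Prop :=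
  xi 0 = p /\
  match y with
  | inl x => exists l : R,
      [/\ 0 <= l,
          forall s t : R, 0 <= s <= l -> 0 <= t <= l ->
            mdist (xi s) (xi t) = `|s - t|,
          forall t : R, l < t -> xi t = xi l & xi l = x]
  | inr v => exists2 zeta : ray, ray_fun zeta = xi & ray_end zeta = v
  end.

(* Uniform convergence on each bounded interval of [0, +oo[. *)
Definition ray_cvg (xi_ : nat -> R -> X) (xi : R -> X) : Prop :=
  forall T : R, {uniform [set t | 0 <= t <= T], xi_ @ \oo --> xi}.

Definition subsequence_index (phi : nat -> nat) : Prop :=
  {homo phi : m n / (m < n)%N}.

(* Convergence in X + boundary through generalized rays from the base point p;
   the theory shows that it does not depend on p. *)
Definition bordification_cvg (p : X) (y_ : nat -> bordification)
    (y : bordification) : Prop :=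
  exists2 xi_ : nat -> R -> X, (forall i, generalized_ray p (xi_ i) (y_ i)) &
    forall phi : nat -> nat, subsequence_index phi ->
      exists psi : nat -> nat, subsequence_index psi /\
      exists2 xi : R -> X, generalized_ray p xi y &
        ray_cvg (fun i => xi_ (phi (psi i))) xi.

End MetricSpaces.

(* Main.v *)
Require Import Defs.
From HB Require Import structures.
From mathcomp Require Import all_boot all_order all_algebra generic_quotient.
From mathcomp Require Import all_classical all_reals all_analysis.
From mathcomp Require Import ring lra.

(** Convexity controls Gromov products: a geodesic from x to y passes within
    (x|y)_p + 2 delta of p and f stays below max (f x) (f y) along it, so
    f p - max (f x) (f y) <= L ((x|y)_p + 2 delta).  Hence any two rays along
    which f is unbounded below are asymptotic, which gives uniqueness.
    Comparing a minimizer in J_tau(x) with points of the convex geodesics from x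
    to xi(t), t -> oo, where xi is a ray of slope - alpha, makes f drop by at
    least alpha^2 tau / 2 per step.  With steps of length at most 2 tau L, f
    decreases at a linear rate along the geodesics from p to x_k, hence along any
    limit ray.  The quantitative bound follows from
    (xi(t)|x_k)_{x_0} >= k alpha^2 tau / (2 L) - 2 delta: it implies the stated
    one if delta <= 2 L tau, and otherwise the stated bound is nonpositive. *)

Set Implicit Arguments.
Unset Strict Implicit.
Unset Printing Implicit Defensive.

Import Order.TTheory GRing.Theory Num.Theory.
Import numFieldNormedType.Exports.

Local Open Scope classical_set_scope.
Local Open Scope ring_scope.

Section Hyperbolic.
Local Open Scope quotient_scope.
Context {R : realType} {X : metricType R}.
Implicit Types (p x y z : X) (xi zeta : ray X) (gamma : R -> X) (s t : R).

(** * Gromov products, rays and points on geodesics *)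

Lemma dist_diff_le p x y : `|mdist p x - mdist p y| <= mdist x y.
Proof.
have := metric_triangle p x y; have := metric_triangle p y x.
by rewrite (metric_sym y x) ler_norml; lra.
Qed.

Lemma gromov_productC p x y : gromov_product p x y = gromov_product p y x.
Proof. by rewrite /gromov_product (metric_sym x y) (addrC (mdist p x)). Qed.

Lemma gromov_product_ge0 p x y : 0 <= gromov_product p x y.
Proof.
rewrite /gromov_product; have := metric_triangle x p y.
by rewrite (metric_sym x p); lra.
Qed.

Lemma hyperbolic_ge delta p x y z m : gromov_hyperbolic X delta ->
  m <= gromov_product p x y -> m <= gromov_product p y z ->
  m - delta <= gromov_product p x z.
Proof.
move=> hyp mxy myz; apply: le_trans (hyp p x y z).
by rewrite lerB// le_min mxy.
Qed.

Lemma ray_geodesic xi t : 0 <= t -> is_geodesic (xi 0) (xi t) (fun s => xi (s * t)).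
Proof.
move=> t0; split; rewrite ?mul0r ?mul1r// => s u /andP[s0 _] /andP[u0 _].
rewrite !ray_isometry ?mulr_ge0// sub0r normrN (ger0_norm t0).
by rewrite -mulrBl normrM (ger0_norm t0).
Qed.

Lemma geodesic_dist0 x y gamma s : is_geodesic x y gamma -> 0 <= s <= 1 ->
  mdist x (gamma s) = s * mdist x y.
Proof.
move=> [g0 _ gd] /[dup] s01 /andP[s0 _]; rewrite -{1}g0 gd ?lexx ?ler01//.
by rewrite sub0r normrN ger0_norm.
Qed.

Lemma geodesic_dist1 x y gamma s : is_geodesic x y gamma -> 0 <= s <= 1 ->
  mdist (gamma s) y = (1 - s) * mdist x y.
Proof.
move=> [_ g1 gd] /[dup] s01 /andP[_ s1]; rewrite -{1}g1 gd ?lexx ?ler01//.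
by rewrite distrC ger0_norm// subr_ge0.
Qed.

Definition unbounded_below_along (f : X -> R) (xi : R -> X) :=
  forall m : R, exists2 t : R, 0 <= t & f (xi t) <= m.

Lemma linear_descent_unbounded (f : X -> R) (xi : R -> X) (a c : R) : 0 < c ->
  (forall t, 0 <= t -> f (xi t) <= a - c * t) -> unbounded_below_along f xi.
Proof.
move=> c0 fa m; have s0 : 0 <= `|a - m| / c by rewrite divr_ge0// ltW.
exists (`|a - m| / c) => //; apply: le_trans (fa _ s0) _.
by rewrite mulrC divfK ?gt_eqF//; have := ler_norm (a - m); lra.
Qed.

(** * Closeness of geodesics, and convex functions on a hyperbolic space *)

Section Delta.
Context {delta : R} (hyp : gromov_hyperbolic X delta).

(** Seen from x, both points have Gromov product s d(x,y) with y. Hyperbolicity bounds their mutual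
    product below by s d(x,y) - delta, and both lie at distance s d(x,y) from x. *)
Lemma geodesics_close x y gamma gamma' s :
  is_geodesic x y gamma -> is_geodesic x y gamma' -> 0 <= s <= 1 ->
  mdist (gamma s) (gamma' s) <= 2 * delta.
Proof.
move=> g g' s01; have := @hyperbolic_ge delta x (gamma s) y (gamma' s)
  (s * mdist x y) hyp.
rewrite (gromov_productC x y) /gromov_product.
rewrite (geodesic_dist0 g s01) (geodesic_dist0 g' s01).
rewrite (geodesic_dist1 g s01) (geodesic_dist1 g' s01).
have h1 : s * mdist x y <=
  2^-1 * (s * mdist x y + mdist x y - (1 - s) * mdist x y) by lra.
by move=> /(_ h1 h1); lra.
Qed.

(** The point z of the geodesic at distance (p|y)_x from x works: (x|z)_p and (z|y)_p then both
    equal half of d(p,z) + (x|y)_p, and hyperbolicity compares this with (x|y)_p. *)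
Lemma geodesic_near_basepoint p x y gamma : is_geodesic x y gamma ->
  exists2 s, 0 <= s <= 1 &
    mdist p (gamma s) <= gromov_product p x y + 2 * delta.
Proof.
move=> g; pose D := mdist x y; pose a := gromov_product x p y.
have aE : 2 * a = mdist p x + D - mdist p y.
  by rewrite /a /gromov_product (metric_sym x p) /D; lra.
have a0 : 0 <= a by exact: gromov_product_ge0.
have := dist_diff_le p x y; rewrite -/D ler_norml => /andP[lo hi].
have [s s01 sD] : exists2 s, 0 <= s <= 1 & s * D = a.
  have [D0|D0] := eqVneq D 0.
    by exists 0; rewrite ?lexx ?ler01// mul0r; lra.
  have Dgt : 0 < D by rewrite lt_neqAle eq_sym D0 mdist_ge0.
  exists (a / D); last by rewrite divfK.
  by rewrite divr_ge0 ?(ltW Dgt)//= ler_pdivrMr// mul1r; lra.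
exists s => //.
have := geodesic_dist0 g s01; have := geodesic_dist1 g s01.
rewrite mulrBl mul1r -/D sD => d1 d0.
have := @hyperbolic_ge delta p x (gamma s) y
  (2^-1 * (mdist p (gamma s) + gromov_product p x y)) hyp.
rewrite /gromov_product d0 d1 -/D.
have h1 : 2^-1 * (mdist p (gamma s) + 2^-1 * (mdist p x + mdist p y - D)) <=
  2^-1 * (mdist p x + mdist p (gamma s) - a) by lra.
have h2 : 2^-1 * (mdist p (gamma s) + 2^-1 * (mdist p x + mdist p y - D)) <=
  2^-1 * (mdist p (gamma s) + mdist p y - (D - a)) by lra.
by move=> /(_ h1 h2); lra.
Qed.

Context {L : R} {f : X -> R} (L_gt0 : 0 < L).
Context (f_lip : lipschitz_fun L f) (f_conv : weakly_convex f).

Lemma lipschitz_le x y : f x <= f y + L * mdist x y.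
Proof. by have := f_lip x y; rewrite ler_norml => /andP[_]; lra. Qed.

Lemma sublevel_gromov_product p x y m : f x <= m -> f y <= m ->
  f p - m <= L * (gromov_product p x y + 2 * delta).
Proof.
move=> fx fy; have [gamma g conv] := f_conv x y.
have [s s01 near] := geodesic_near_basepoint p g.
have := conv s s01; have := lipschitz_le p (gamma s).
have : L * mdist p (gamma s) <= L * (gromov_product p x y + 2 * delta).
  by rewrite ler_pM2l.
case/andP: s01 => s0 s1.
have : s * f y <= s * m by rewrite ler_wpM2l.
have : (1 - s) * f x <= (1 - s) * m by rewrite ler_wpM2l// subr_ge0.
lra.
Qed.

Lemma unbounded_below_far xi s m : unbounded_below_along f xi -> 0 <= s ->
  exists2 t, s <= t & f (xi t) <= m.
Proof.
(* By the Lipschitz bound, a value at most f (xi 0) - L s cannot be reached before time s. *)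
move=> /(_ (Num.min m (f (xi 0) - L * s))) [t t0].
rewrite le_min => /andP[ftm fts] s0; exists t => //.
have := lipschitz_le (xi 0) (xi t); rewrite ray_isometry// sub0r normrN ger0_norm//.
by move=> h; rewrite -(ler_pM2l L_gt0); lra.
Qed.

(** Hyperbolicity is applied twice along the chain xi s, xi t, zeta u, zeta s with t and u far out,
    giving (xi s|zeta s)_p >= s - c - 2 delta. The offset c accounts for the different starting
    points. *)
Lemma unbounded_below_ray_end xi zeta : 0 <= delta ->
  unbounded_below_along f xi -> unbounded_below_along f zeta ->
  ray_end xi = ray_end zeta.
Proof.
move=> delta0 uxi uzeta; apply/eqmodP/asboolP.
set p := xi 0; set c := mdist p (zeta 0).
have c0 : 0 <= c by exact: mdist_ge0.
exists (3 * c + 4 * delta) => s s0.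
(* This level is the one for which [sublevel_gromov_product] yields (xi t|zeta u)_p >= s. *)
have [t st ft] := unbounded_below_far (f p - L * (s + 2 * delta)) uxi s0.
have [u su fu] := unbounded_below_far (f p - L * (s + 2 * delta)) uzeta s0.
have tu : s <= gromov_product p (xi t) (zeta u).
  have := sublevel_gromov_product p ft fu.
  by rewrite opprB addrCA subrr addr0 ler_pM2l//; lra.
have t0 := le_trans s0 st; have u0 := le_trans s0 su.
have dxi (v : R) : 0 <= v -> mdist p (xi v) = v.
  by move=> v0; rewrite /p ray_isometry// sub0r normrN ger0_norm.
have dzeta (v : R) : 0 <= v -> `|mdist p (zeta v) - v| <= c.
  move=> v0; have := metric_triangle p (zeta 0) (zeta v).
  have := metric_triangle (zeta 0) p (zeta v).
  rewrite (metric_sym (zeta 0) p) ray_isometry// sub0r normrN (ger0_norm v0).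
  by rewrite ler_norml /c; lra.
have st' : s <= gromov_product p (xi s) (xi t).
  by rewrite /gromov_product !dxi// ray_isometry// distrC ger0_norm ?subr_ge0//; lra.
have us : s - c <= gromov_product p (zeta u) (zeta s).
  rewrite /gromov_product ray_isometry// ger0_norm ?subr_ge0//.
  by have := dzeta _ s0; have := dzeta _ u0; rewrite !ler_norml; lra.
have := @hyperbolic_ge delta p (xi s) (zeta u) (zeta s) (s - c - delta) hyp.
have := @hyperbolic_ge delta p (xi s) (xi t) (zeta u) s hyp st' tu.
move=> su' h; have := dzeta _ s0; rewrite ler_norml => /andP[_ dz].
have a1 : s - c - delta <= gromov_product p (xi s) (zeta u) by lra.
have a2 : s - c - delta <= gromov_product p (zeta u) (zeta s) by lra.
by have := h a1 a2; rewrite {1}/gromov_product dxi//; lra.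
Qed.

(** Convexity is only available along some geodesic from xi 0 to xi t; it stays 2 delta close to the
    ray, which costs 2 L delta. Clearing the denominator t covers t = 0. *)
Lemma ray_convex xi s t : 0 <= s <= t ->
  t * (f (xi s) - f (xi 0) - 2 * L * delta) <= s * (f (xi t) - f (xi 0)).
Proof.
move=> /andP[s0 st]; have t0 := le_trans s0 st.
have [t00|tn0] := eqVneq t 0.
  have s00 : s = 0 by lra.
  by rewrite s00 t00 !mul0r.
have tgt : 0 < t by rewrite lt_neqAle eq_sym tn0.
have [gamma g conv] := f_conv (xi 0) (xi t).
have q01 : 0 <= s / t <= 1 by rewrite divr_ge0// ler_pdivrMr// mul1r.
have := geodesics_close (ray_geodesic xi t0) g q01.
rewrite divfK// => close.
have h1 := lipschitz_le (xi s) (gamma (s / t)).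
have h2 : L * mdist (xi s) (gamma (s / t)) <= L * (2 * delta) by rewrite ler_pM2l.
have h3 := conv _ q01.
have h : f (xi s) - f (xi 0) - 2 * L * delta <= s / t * (f (xi t) - f (xi 0)).
  by rewrite mulrBr; rewrite mulrBl mul1r in h3; lra.
have := ler_wpM2l t0 h; rewrite [in X in _ <= X -> _]mulrA.
by rewrite [t * (s / t)]mulrC divfK.
Qed.

(** By [ray_convex] the corrected quotient q is increasing up to an error C / t, so its supremum,
    finite by the Lipschitz bound, is the limit. The linear bound on f is q t <= sup q. *)
Lemma ray_slope xi : exists2 l : R,
  f (xi t) / t @[t --> +oo] --> l &
  forall t, 0 <= t -> f (xi t) <= f (xi 0) + 2 * L * delta + l * t.
Proof.
pose C := 2 * L * delta; pose q s := (f (xi s) - f (xi 0) - C) / s.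
have qle s t : 0 < s <= t -> q s <= (f (xi t) - f (xi 0)) / t.
  move=> /andP[s0 st]; have t0 := lt_le_trans s0 st.
  rewrite /q ler_pdivrMr// mulrAC ler_pdivlMr//.
  by rewrite mulrC (mulrC (_ - _) s); apply: ray_convex; rewrite ltW.
pose E := [set q s | s in [set s | 0 < s]].
have supE : has_sup E.
  split; first by exists (q 1), 1; rewrite //= ltr01.
  exists L => _ [s /= s0 <-]; apply: (le_trans (qle s s _)); first by rewrite s0 lexx.
  rewrite ler_pdivrMr//; have := lipschitz_le (xi s) (xi 0).
  by rewrite ray_isometry ?(ltW s0)// subr0 (ger0_norm (ltW s0)); lra.
have qsup s : 0 < s -> q s <= sup E.
  by move=> s0; apply: ub_le_sup => //; [case: supE|exists s].
exists (sup E); last first.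
  move=> t; rewrite le_eqVlt => /predU1P[<-|t0].
    (* At t = 0 the claim is 0 <= C, which is approximate convexity between times 0 and 1. *)
    have := @ray_convex xi 0 1; rewrite lexx ler01 mul0r mul1r => /(_ isT).
    by rewrite mulr0; lra.
  by have := qsup t t0; rewrite /q ler_pdivrMr// /C; lra.
apply/cvgrPdist_le => e e0.
have [_ [s /= s0 <-] qs] := sup_adherent (divr_gt0 e0 (ltr0Sn R 1)) supE.
pose b := `|f (xi 0)| + `|C|.
(* Past s, the near-supremum q s bounds the quotient from below; past 2 b / e, the terms f (xi 0) /
   t and (f (xi 0) + C) / t are at most e / 2. *)
exists (Num.max s (2 * b / e)); split; first exact: num_real.
move=> t; rewrite gt_max => /andP[st bt].
have t0 := lt_trans s0 st.
have tV : 0 < t^-1 by rewrite invr_gt0.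
have bt' : b / t <= e / 2.
  by move: bt; rewrite ltr_pdivrMr// ler_pdivrMr//; lra.
have l1 := qle s t; rewrite s0 ltW// in l1; have {}l1 := l1 isT.
have l2 := qsup t t0.
have f0 : `|f (xi 0) / t| <= e / 2.
  apply: le_trans bt'; rewrite normrM (gtr0_norm tV).
  by rewrite ler_pM2r// /b lerDl.
have fC : `|(f (xi 0) + C) / t| <= e / 2.
  apply: le_trans bt'; rewrite normrM (gtr0_norm tV).
  by rewrite ler_pM2r// /b ler_normD.
move: f0 fC l1 l2 qs; rewrite /q !ler_norml !mulrBl !mulrDl.
by move=> /andP[? ?] /andP[? ?]; lra.
Qed.

Lemma asymptotic_slope_fin v : exists2 l : R, asymptotic_slope f v = l%:E &
  exists xi : ray X, ray_end xi = v /\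
    exists a, forall t, 0 <= t -> f (xi t) <= a + l * t.
Proof.
set xi : ray X := repr (v : {eq_quot asymptotic_equiv X}).
have [l cvl le] := ray_slope xi; exists l.
  by apply: cvg_lim => //; apply: cvg_EFin => //; exact: nearW.
exists xi; split; first exact: reprK.
by exists (f (xi 0) + 2 * L * delta).
Qed.

End Delta.

(** * Compactness: locally uniform limits of curves in a proper space *)

Lemma closed_ball_compact p (r : R) : proper_space X ->
  compact [set y | mdist p y <= r].
Proof.
move=> proper; apply: proper.
  exists (r + r) => x y /= px py; apply: le_trans (metric_triangle x p y) _.
  by rewrite (metric_sym x p) lerD.
move=> y cly /=; apply/ler_addgt0Pr => e e0.
have [z [/= pz]] := cly _ (nbhsx_ballx y e e0).
rewrite ballEmdist /= metric_sym => zy.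
by apply: le_trans (metric_triangle p z y) _; rewrite lerD// ltW.
Qed.

(** Compactness of the ball gives a cluster point. An ultrafilter contains each set or its
    complement, and clustering rules out the complement, so the cluster point is a limit. *)
Lemma ultra_limit (U : set_system nat) p (r : R) (y : nat -> X) :
  UltraFilter U -> proper_space X -> (forall i, mdist p (y i) <= r) ->
  exists z, forall e : R, 0 < e -> \forall i \near U, mdist z (y i) < e.
Proof.
move=> UU proper yr.
have UF : ProperFilter U by exact: ultra_proper.
have [|z [_ clz]] := @closed_ball_compact p r proper _ (fmap_proper_filter y UF).
  by apply: (@filterE _ U) => i; exact: yr.
exists z => e e0.
have [//|Uc] := in_ultra_setVsetC [set i | mdist z (y i) < e] UU.
have [x []] := clz [set x | ~ mdist z x < e] _ Uc (nbhsx_ballx z e e0).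
by rewrite ballEmdist.
Qed.

Lemma ray_cvgP (g : nat -> R -> X) (h : R -> X) :
  ray_cvg g h <-> forall T e : R, 0 < e ->
    \forall n \near \oo, forall t, 0 <= t <= T -> mdist (h t) (g n t) < e.
Proof.
split=> [gh T e e0|gh T].
  have := gh T [set k | forall t, 0 <= t <= T -> mdist (h t) (k t) < e].
  apply; apply/uniform_nbhs.
  exists [set xy | mdist xy.1 xy.2 < e]; split=> //.
  rewrite -entourage_ballE; exists e => //= xy /=.
  by rewrite ballEmdist.
move=> P /uniform_nbhs[E [entE EP]].
move: entE; rewrite -entourage_ballE => -[e /= e0 eE].
apply: filterS (gh T e e0) => n gn; apply: EP => t tT.
by apply: eE => /=; rewrite ballEmdist; exact: gn.
Qed.

Lemma subsequence_index_ge phi n : subsequence_index phi -> (n <= phi n)%N.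
Proof.
by move=> inc; elim: n => // n IHn; apply: leq_ltn_trans IHn (inc _ _ _).
Qed.

(* An ultrafilter yields pointwise limits at all times at once; equicontinuity
   then upgrades pointwise closeness on a finite grid to uniform closeness. *)
Lemma ascoli_subsequence (g : nat -> R -> X) p : proper_space X ->
  (forall i, g i 0 = p) ->
  (forall i s t, 0 <= s -> 0 <= t -> mdist (g i s) (g i t) <= `|s - t|) ->
  exists h psi, subsequence_index psi /\ ray_cvg (fun i => g (psi i)) h.
Proof.
move=> proper g0 glip.
have [U [UU ooU]] := ultraFilterLemma eventually_filter.
(* The condition on t sits under the existential so that [choice] applies to all real t; negative
   times get the dummy value p. *)
have ptlim t : exists z, 0 <= t ->
    forall e : R, 0 < e -> \forall i \near U, mdist z (g i t) < e.
  have [t0|tn] := boolP (0 <= t); last by exists p.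
  have [|z zlim] := @ultra_limit U p t (fun i => g i t) UU proper; last by exists z.
  by move=> i; rewrite -(g0 i) (le_trans (glip _ _ _ _ _))// sub0r normrN ger0_norm.
have [h hlim] := choice ptlim.
have hlip s t : 0 <= s -> 0 <= t -> mdist (h s) (h t) <= `|s - t|.
  move=> s0 t0; apply/ler_addgt0Pr => e e0; have e2 : 0 < e / 2 by lra.
  have [i [si ti]] := filter_ex (filterI (hlim s s0 _ e2) (hlim t t0 _ e2)).
  have := glip i s t s0 t0; have := metric_triangle (h s) (g i s) (h t).
  have := metric_triangle (g i s) (g i t) (h t).
  by rewrite (metric_sym (g i t) (h t)); move: si ti => /=; lra.
have unif (n m : nat) : exists i, (m < i)%N /\
    forall t, 0 <= t <= n%:R -> mdist (h t) (g i t) < n.+1%:R^-1.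
  (* One third for each leg of the path h t, h s, g i s, g i t, where s is the grid point just below
     t. *)
  pose eta : R := 3^-1 * n.+1%:R^-1.
  have eta0 : 0 < eta by rewrite mulr_gt0 ?invr_gt0.
  pose N := (Num.truncn (n%:R / eta)).+1.
  have grid : \forall i \near U, forall j : 'I_N,
      mdist (h (j%:R * eta)) (g i (j%:R * eta)) < eta.
    by apply: filter_forall => j; apply: hlim => //; rewrite mulr_ge0// ltW.
  have big : \forall i \near U, (m < i)%N by apply: ooU; exact: nbhs_infty_gt.
  have [i [gi mi]] := filter_ex (filterI grid big).
  exists i; split=> // t /andP[t0 tn].
  have te0 : 0 <= t / eta by rewrite divr_ge0// ltW.
  have /andP[jt tj] := truncn_itv te0.
  have jN : (Num.truncn (t / eta) < N)%N.
    by rewrite ltnS le_truncn// ler_pM2r ?invr_gt0.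
  pose s := (Num.truncn (t / eta))%:R * eta.
  have his : mdist (h s) (g i s) < eta by exact: gi (Ordinal jN).
  have s0 : 0 <= s by rewrite mulr_ge0// ltW.
  have st : `|t - s| <= eta.
    have sl : s <= t by rewrite /s -ler_pdivlMr.
    move: tj; rewrite ltr_pdivrMr// -natr1 mulrDl mul1r => tl.
    by rewrite ger0_norm ?subr_ge0// lerBlDl ltW.
  have := hlip t s t0 s0; have := glip i s t s0 t0; rewrite (distrC s t).
  have := metric_triangle (h t) (h s) (g i t).
  have := metric_triangle (h s) (g i s) (g i t).
  have <- : 3 * eta = n.+1%:R^-1 by rewrite /eta mulrA divff ?mul1r.
  by clearbody s; move: his st; lra.
have [c cP] := choice (fun nm : nat * nat => unif nm.1 nm.2).
(* Each index is chosen beyond the previous one, so psi is increasing, and is 1 / (n + 1)-close to h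
   on [0, n]. *)
pose psi := fix psi n := if n is n'.+1 then c (n, psi n') else c (0%N, 0%N).
have psiP n t : 0 <= t <= n%:R -> mdist (h t) (g (psi n) t) < n.+1%:R^-1.
  by case: n => [|n] /=; [have [_] := cP (0%N, 0%N)|have [_] := cP (n.+1, psi n)]; apply.
exists h, psi; split.
  by apply: homo_ltn => [|n]; [exact: ltn_trans|have [] := cP (n.+1, psi n)].
apply/ray_cvgP => T e e0.
near=> n => t /andP[t0 tT].
have nT : T <= n%:R by near: n; exact: nbhs_infty_ger.
apply: lt_trans (psiP n t _) _; first by rewrite t0 (le_trans tT).
near: n; exact: near_infty_natSinv_lt (PosNum e0).
Unshelve. all: by end_near. Qed.

(** Arc-length reparametrization, frozen at y from time D on, as generalized rays require. If D = 0,
    the quotient by zero is 0 and the curve is constant. *)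
Lemma unit_speed_geodesic x y gamma : is_geodesic x y gamma ->
  let D := mdist x y in let g t := gamma (Num.min t D / D) in
  [/\ generalized_ray x g (inl y),
      forall s t, 0 <= s -> 0 <= t ->
        mdist (g s) (g t) = `|Num.min s D - Num.min t D| &
      g 0 = x].
Proof.
move=> gg D g; have D0 : 0 <= D by exact: mdist_ge0.
have [g0 g1 gd] := gg.
have g0' : g 0 = x by rewrite /g (min_idPl D0) mul0r.
have gdist s t : 0 <= s -> 0 <= t ->
    mdist (g s) (g t) = `|Num.min s D - Num.min t D|.
  move=> s0 t0; rewrite /g.
  have [Dz|Dn] := eqVneq D 0.
    by rewrite Dz (min_idPr s0) (min_idPr t0) subrr normr0 mdistxx.
  have Dgt : 0 < D by rewrite lt_neqAle eq_sym Dn.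
  have in01 u : 0 <= u -> 0 <= Num.min u D / D <= 1.
    move=> u0; rewrite divr_ge0 ?le_min ?u0//= ler_pdivrMr// mul1r.
    by rewrite ge_min lexx orbT.
  by rewrite gd ?in01// -mulrBl normrM (gtr0_norm (x := D^-1)) ?invr_gt0// divfK.
split=> //; split=> //; exists D; split=> //.
- move=> s t /andP[s0 sD] /andP[t0 tD].
  by rewrite gdist// (min_idPl sD) (min_idPl tD).
- by move=> t Dt; rewrite /g minxx (min_idPr (ltW Dt)).
- apply: mdist_positivity; rewrite /g minxx.
  have [Dz|Dn] := eqVneq D 0; first by rewrite Dz mul0r g0.
  by rewrite divff// g1 mdistxx.
Qed.

(** * Convergence to the boundary under linear descent *)

Section Descent.
Context {L : R} {f : X -> R} (L_gt0 : 0 < L).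
Context (f_lip : lipschitz_fun L f) (f_conv : weakly_convex f).

(** The generalized rays are the convex geodesics from p to y i. Subsequences have limits by Ascoli;
    each limit is a ray because the lengths tend to infinity, and it inherits the descent rate
    kappa, hence represents v. *)
Lemma linear_descent_cvg (y : nat -> X) p (kappa : R) (v : boundary X) :
  proper_space X -> 0 < kappa ->
  (forall T : R, \forall i \near \oo, T <= mdist p (y i)) ->
  (\forall i \near \oo, f (y i) <= f p - kappa * mdist p (y i)) ->
  (forall xi : ray X, unbounded_below_along f xi -> ray_end xi = v) ->
  bordification_cvg p (fun i => inl (y i)) (inr v).
Proof.
move=> proper kappa0 yoo ydesc toend.
have /choice[gamma gammaP] : forall i, exists gamma, is_geodesic p (y i) gamma /\
    forall s, 0 <= s <= 1 -> f (gamma s) <= (1 - s) * f p + s * f (y i).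
  by move=> i; have [gamma] := f_conv p (y i); exists gamma.
pose D i := mdist p (y i); pose g i t := gamma i (Num.min t (D i) / D i).
have gP i := unit_speed_geodesic (gammaP i).1.
exists g => [i|phi phi_inc]; first by have [] := gP i.
have [| |h [psi [psi_inc gh]]] := @ascoli_subsequence (g \o phi) p proper.
- by move=> i; have [] := gP (phi i).
- move=> i s t s0 t0 /=; have [_ -> //] := gP (phi i).
  (* Truncating time at d is 1-Lipschitz. *)
  set d := mdist _ _; rewrite !minEle.
  have [] := leP s d; have [] := leP t d; rewrite ?subrr ?normr0//.
  + by move=> dt sd; rewrite distrC (distrC s) !ger0_norm; lra.
  + by move=> td ds; rewrite !ger0_norm; lra.
exists psi; split=> //.
have sub P : (\forall i \near \oo, P i) -> \forall n \near \oo, P (phi (psi n)).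
  move=> [N _ NP]; exists N => // n Nn; apply: NP => /=.
  apply: leq_trans Nn (leq_trans (subsequence_index_ge n psi_inc) _).
  exact: subsequence_index_ge.
have hlim t e : 0 <= t -> 0 < e -> \forall n \near \oo,
    mdist (h t) (g (phi (psi n)) t) < e /\ t <= D (phi (psi n)).
  move=> t0 e0; apply: filterS2 ((ray_cvgP _ _).1 gh t e e0) (sub _ (yoo t)).
  by move=> n close tD; split=> //; apply: close; rewrite t0 lexx.
have h_iso s t : 0 <= s -> 0 <= t -> mdist (h s) (h t) = `|s - t|.
  move=> s0 t0; apply/eqP; rewrite -subr_eq0 -normr_le0; apply/ler_addgt0Pr => e e0.
  have e2 : 0 < e / 2 by lra.
  have [n [[si sD] [ti tD]]] := filter_ex (filterI (hlim s _ s0 e2) (hlim t _ t0 e2)).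
  set i := phi (psi n) in si sD ti tD.
  have gst : mdist (g i s) (g i t) = `|s - t|.
    by have [_ -> // _] := gP i; rewrite -/(D i) (min_idPl sD) (min_idPl tD).
  have := dist_diff_le (h s) (h t) (g i t); have := dist_diff_le (g i t) (h s) (g i s).
  rewrite (metric_sym (g i t) (g i s)) gst (metric_sym (g i t) (h s)) add0r.
  by rewrite !ler_norml => /andP[? ?] /andP[? ?]; apply/andP; split; lra.
have h0 : h 0 = p.
  apply: mdist_positivity; apply/eqP; rewrite eq_le mdist_ge0 andbT.
  apply/ler_addgt0Pr => e e0; have [n [hn _]] := filter_ex (hlim 0 e (lexx 0) e0).
  have [_ _ gi0] := gP (phi (psi n)).
  by rewrite add0r -[X in mdist _ X]gi0 ltW.
have fh t : 0 <= t -> f (h t) <= f p - kappa * t.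
  rewrite le_eqVlt => /predU1P[<-|t0]; first by rewrite h0 mulr0 subr0.
  (* Distance e / L costs at most e in f. Time t on [g i] is the parameter t / D i, where convexity
     gives f <= f p - kappa t. *)
  apply/ler_addgt0Pr => e e0; have e1 : 0 < e / L by rewrite divr_gt0.
  have [n [[hn tD] fn]] := filter_ex (filterI (hlim t _ (ltW t0) e1) (sub _ ydesc)).
  set i := phi (psi n) in hn tD fn.
  have D0 : 0 < D i by exact: lt_le_trans tD.
  have h1 := lipschitz_le f_lip (h t) (g i t).
  have h2 : L * mdist (h t) (g i t) <= e.
    by rewrite mulrC -ler_pdivlMr// ltW.
  have h3 : f (g i t) <= (1 - t / D i) * f p + t / D i * f (y i).
    rewrite /g (min_idPl tD); apply: (gammaP i).2.
    by rewrite divr_ge0 ?(ltW t0) ?(ltW D0)//= ler_pdivrMr// mul1r.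
  have : t / D i * f (y i) <= t / D i * (f p - kappa * D i).
    by rewrite ler_wpM2l// divr_ge0// ltW.
  have -> : t / D i * (f p - kappa * D i) = t / D i * f p - kappa * t.
    by field; rewrite gt_eqF.
  lra.
exists h => //; split=> //; exists (Ray h_iso) => //; apply: toend.
exact: linear_descent_unbounded kappa0 fh.
Qed.

(** * Proximal steps and discrete gradient curves *)

Context {tau alpha : R} (tau_gt0 : 0 < tau) (alpha_gt0 : 0 < alpha).

(** Comparing the minimizer with x itself gives d(x,z)^2 / (2 tau) <= f x - f z <= L d(x,z). *)
Lemma proximal_step_le x z : proximal f tau x z -> mdist x z <= 2 * tau * L.
Proof.
move=> /(_ x); rewrite mdistxx expr0n/= mul0r addr0 => prox.
have [->|xz] := eqVneq x z; first by rewrite mdistxx !mulr_ge0// ltW.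
have d0 : 0 < mdist x z by rewrite mdist_gt0.
have : mdist x z ^+ 2 / (2 * tau) <= L * mdist x z.
  by have := lipschitz_le f_lip x z; lra.
rewrite ler_pdivrMr ?mulr_gt0// expr2 => h.
by rewrite -(ler_pM2r d0); lra.
Qed.

Section AlongRay.
Context {xi : ray X} {a : R}.
Context (f_xi : forall t, 0 <= t -> f (xi t) <= a - alpha * t).

(* Compare z with the point at distance b * tau from x on the convex geodesic
   from x to xi t, whose f-slope is at most - b once t is large. *)
Lemma proximal_descent_lt x z (b : R) : 0 < b < alpha ->
  proximal f tau x z -> f z <= f x - b ^+ 2 * tau / 2.
Proof.
move=> /andP[b0 ba] prox.
pose c := mdist x (xi 0); have c0 : 0 <= c by exact: mdist_ge0.
(* The excess slope alpha - b over time q absorbs the offsets [|a - f x|] and b c; the extra b tau +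
   c in t ensures b tau <= D. *)
pose q := (`|a - f x| + b * c) / (alpha - b).
have q0 : 0 <= q.
  by apply: divr_ge0; [rewrite addr_ge0// mulr_ge0// ltW|lra].
have bt0 : 0 < b * tau by rewrite mulr_gt0.
pose t := q + b * tau + c; have t0 : 0 <= t by rewrite /t; lra.
pose D := mdist x (xi t).
have Dlo : t - c <= D.
  have := metric_triangle (xi 0) x (xi t).
  by rewrite ray_isometry// sub0r normrN ger0_norm// (metric_sym _ x) -/c -/D; lra.
have Dhi : D <= c + t.
  have := metric_triangle x (xi 0) (xi t).
  by rewrite ray_isometry// sub0r normrN ger0_norm.
have D0 : 0 < D by rewrite /t in Dlo; lra.
have fD : f (xi t) - f x <= - (b * D).
  have h1 := f_xi t0.
  have h2 : (alpha - b) * q = `|a - f x| + b * c.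
    by rewrite /q mulrC divfK// gt_eqF; lra.
  have h3 : (alpha - b) * q <= (alpha - b) * t by rewrite ler_pM2l /t; lra.
  have h4 : b * D <= b * (c + t) by rewrite ler_pM2l.
  by have := ler_norm (a - f x); lra.
have [gamma g conv] := f_conv x (xi t).
have s01 : 0 <= b * tau / D <= 1.
  by rewrite divr_ge0 ?(ltW bt0) ?(ltW D0)//= ler_pdivrMr// mul1r /t in Dlo *; lra.
have := prox (gamma (b * tau / D)); have := conv _ s01.
rewrite (geodesic_dist0 g s01) -/D divfK ?gt_eqF//.
have : b * tau / D * (f (xi t) - f x) <= b * tau / D * - (b * D).
  by rewrite ler_wpM2l//; case/andP: s01.
(* The length r = b tau maximizes b r - r^2 / (2 tau): a drop of b^2 tau against a penalty of half
   that size. *)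
have -> : b * tau / D * - (b * D) = - (b ^+ 2 * tau) by field; rewrite gt_eqF.
have -> : (b * tau) ^+ 2 / (2 * tau) = b ^+ 2 * tau / 2 by field; rewrite gt_eqF.
have : 0 <= mdist x z ^+ 2 / (2 * tau) by rewrite divr_ge0 ?sqr_ge0// mulr_ge0// ltW.
lra.
Qed.

Lemma proximal_descent x z : proximal f tau x z ->
  f z <= f x - alpha ^+ 2 * tau / 2.
Proof.
move=> prox; apply/ler_addgt0Pr => e e0.
have at0 : 0 < alpha * tau by rewrite mulr_gt0.
(* Slope b = alpha - m loses at most m alpha tau <= e; m <= alpha / 2 keeps b positive. *)
pose m := Num.min (alpha / 2) (e / (alpha * tau)).
have m0 : 0 < m by rewrite lt_min !divr_gt0.
have ma : m <= alpha / 2 by rewrite ge_min lexx.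
have me : m * (alpha * tau) <= e by rewrite -ler_pdivlMr// ge_min lexx orbT.
have b01 : 0 < alpha - m < alpha by apply/andP; split; lra.
apply: le_trans (proximal_descent_lt b01 prox) _.
have : 0 <= m ^+ 2 * tau by rewrite mulr_ge0 ?sqr_ge0// ltW.
rewrite !expr2; lra.
Qed.

Lemma gradient_curve_descent x0 (x : nat -> X) k :
  discrete_gradient_curve f tau x0 x ->
  f (x k) <= f x0 - k%:R * (alpha ^+ 2 * tau / 2).
Proof.
move=> [x00 prox]; elim: k => [|k IHk]; first by rewrite x00 mul0r subr0.
by have := proximal_descent (prox k.+1 isT); rewrite /= -[k.+1%:R]natr1; lra.
Qed.

Lemma gradient_curve_dist x0 (x : nat -> X) k :
  discrete_gradient_curve f tau x0 x -> mdist x0 (x k) <= k%:R * (2 * tau * L).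
Proof.
move=> [x00 prox]; elim: k => [|k IHk]; first by rewrite x00 mul0r mdistxx.
have := proximal_step_le (prox k.+1 isT); rewrite /= -[k.+1%:R]natr1.
by have := metric_triangle x0 (x k) (x k.+1); lra.
Qed.

Lemma gradient_curve_cvg x0 (x : nat -> X) p (v : boundary X) :
  proper_space X -> discrete_gradient_curve f tau x0 x ->
  (forall xi : ray X, unbounded_below_along f xi -> ray_end xi = v) ->
  bordification_cvg p (fun i => inl (x i.+1)) (inr v).
Proof.
move=> proper curve toend.
pose c := alpha ^+ 2 * tau / 2; pose B := 2 * tau * L.
have c0 : 0 < c by rewrite !mulr_gt0// exprn_gt0.
have B0 : 0 < B by rewrite !mulr_gt0.
have fx i := gradient_curve_descent i.+1 curve.
have dx i := gradient_curve_dist i.+1 curve.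
(* The curve drops by c per step of length at most B. Half the ratio c / B leaves slack c / 2 per
   step, which eventually absorbs f x0 - f p and d(p,x0). *)
pose kappa := c / 2 / B; have kappa0 : 0 < kappa by do 2?apply: divr_gt0.
have kappaB : kappa * B = c / 2 by rewrite divfK// gt_eqF.
apply: (@linear_descent_cvg _ _ kappa) => //.
(* A Lipschitz f tending to minus infinity along the curve forces the distance from p to
   infinity. *)
- move=> T; near=> i.
  have big : (f x0 - f p + L * T) / c <= i%:R by near: i; exact: nbhs_infty_ger.
  rewrite -(ler_pM2l L_gt0); have := lipschitz_le f_lip p (x i.+1).
  have := fx i; rewrite -/c -[i.+1%:R]natr1.
  by move: big; rewrite ler_pdivrMr//; lra.
- near=> i.
  have big : (f x0 - f p + kappa * mdist p x0) / (c / 2) <= i%:R.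
    by near: i; exact: nbhs_infty_ger.
  have : kappa * mdist p (x i.+1) <= kappa * (mdist p x0 + i.+1%:R * B).
    rewrite ler_pM2l//; apply: le_trans (metric_triangle p x0 _) _.
    by rewrite lerD2l; exact: dx.
  rewrite mulrDr mulrCA kappaB.
  have := fx i; rewrite -/c -[i.+1%:R]natr1.
  have c20 : 0 < c / 2 by rewrite divr_gt0.
  by move: big; rewrite ler_pdivrMr//; lra.
Unshelve. all: by end_near. Qed.

End AlongRay.
End Descent.
End Hyperbolic.

(** * Arithmetic of the quantitative bound *)

Lemma sqrt_bound_le (R : realType) (L alpha tau delta k m : R) :
  0 < L -> 0 < alpha <= L -> 0 < tau -> 0 <= delta -> 1 <= k -> 0 <= m ->
  k * (alpha ^+ 2 * tau / 2) <= L * (m + 2 * delta) ->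
  k * Num.sqrt tau *
    ((alpha ^+ 2 / (4 * L) + alpha ^+ 4 / (16 * L ^+ 3)) * Num.sqrt tau
     - 2 * Num.sqrt (2 * L * delta)) <= m.
Proof.
move=> L0 /andP[a0 aL] tau0 delta0 k1 m0 hm.
set S := Num.sqrt tau; set Q := Num.sqrt _.
have S0 : 0 < S by rewrite sqrtr_gt0.
have Q0 : 0 <= Q by exact: sqrtr_ge0.
have SS : S ^+ 2 = tau by rewrite sqr_sqrtr// ltW.
have QQ : Q ^+ 2 = 2 * L * delta by rewrite sqr_sqrtr// !mulr_ge0// ltW.
pose A := alpha ^+ 2 / L.
have A0 : 0 <= A by rewrite divr_ge0 ?sqr_ge0// ltW.
have AL : A <= L by rewrite ler_pdivrMr// -expr2 lerXn2r// nnegrE ltW.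
set w := alpha ^+ 2 / (4 * L) + _.
(* Indeed w = A / 4 + A^2 / (16 L), and A <= L since alpha <= L. *)
have wA : w <= 5 / 16 * A.
  have -> : w = A / 4 + A * (A / L) / 16 by rewrite /w /A; field; rewrite gt_eqF.
  have : A * (A / L) <= A * 1 by rewrite ler_wpM2l// ler_pdivrMr// mul1r.
  lra.
have k0 : 0 <= k by lra.
have kS : 0 <= k * S by rewrite mulr_ge0// ltW.
have {hm}hm : k * A * S ^+ 2 / 2 <= m + 2 * delta.
  rewrite SS -(ler_pM2l L0); apply: le_trans hm.
  by rewrite le_eqVlt; apply/orP; left; apply/eqP; rewrite /A; field; rewrite gt_eqF.
have wS : w * S <= 5 / 16 * A * S by rewrite ler_pM2r.
(* The case Q <= 2 L S means delta <= 2 L tau. Then Q^2 = 2 L delta gives 2 delta <= 2 S Q <= 2 k S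
   Q, using 1 <= k. *)
have [QS|QS] := leP Q (2 * L * S).
  have dQ : 2 * delta <= 2 * S * Q.
    rewrite -(ler_pM2l L0) mulrA (mulrC L 2) -QQ expr2.
    by have := ler_wpM2r Q0 QS; lra.
  have : k * S * (w * S - 2 * Q) <= k * S * (5 / 16 * A * S - 2 * Q).
    by rewrite ler_wpM2l// lerB.
  have : 0 <= k * A * S ^+ 2 by rewrite mulr_ge0 ?sqr_ge0// mulr_ge0.
  have : 0 <= (k - 1) * (S * Q) by rewrite !mulr_ge0// ?subr_ge0// ltW.
  rewrite !expr2 in hm *; lra.
(* Otherwise w S <= 5/16 L S < 2 Q, so the left side is nonpositive. *)
apply: le_trans m0; rewrite mulr_ge0_le0// subr_le0; apply: le_trans wS _.
have : A * S <= L * S by rewrite ler_pM2r.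
have := mulr_gt0 L0 S0; lra.
Qed.

(** * The boundary point of negative slope, and convergence towards it *)

Theorem theorem1p1 (R : realType) (X : metricType R) (delta L tau : R)
    (f : X -> R)
    (delta_ge0 : 0 <= delta)
    (X_proper : proper_space X)
    (X_geodesic : geodesic_space X)
    (X_hyperbolic : gromov_hyperbolic X delta)
    (boundary_neq0 : [set: boundary X] !=set0)
    (L_gt0 : 0 < L)
    (f_lipschitz : lipschitz_fun L f)
    (f_convex : weakly_convex f)
    (rate_gt0 : (0 < descent_rate f)%E)
    (tau_gt0 : 0 < tau) :
  let alpha : R := fine (descent_rate f) in
  exists vstar : boundary X,
  [/\ unique (fun v : boundary X => (asymptotic_slope f v < 0)%E) vstar,
      forall (x0 : X) (x : nat -> X), discrete_gradient_curve f tau x0 x ->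
        forall p : X,
          bordification_cvg p (fun i : nat => inl (x i.+1)) (inr vstar) &
      forall (x0 : X) (x : nat -> X), discrete_gradient_curve f tau x0 x ->
        forall xi : ray X, ray_end xi = vstar -> xi 0 = x0 ->
        forall (k : nat) (t : R), (0 < k)%N -> 0 < t -> f (xi t) <= f (x k) ->
          k%:R * Num.sqrt tau *
            ((alpha ^+ 2 / (4 * L) + alpha ^+ 4 / (16 * L ^+ 3)) * Num.sqrt tau
             - 2 * Num.sqrt (2 * L * delta))
          <= gromov_product x0 (xi t) (x k)].
Proof.
move=> alpha.
have slopeP := asymptotic_slope_fin X_hyperbolic L_gt0 f_lipschitz f_convex.
have slope_end (v w : boundary X) : (asymptotic_slope f v < 0)%E ->
    (asymptotic_slope f w < 0)%E -> v = w.
  have unb (u : boundary X) : (asymptotic_slope f u < 0)%E -> exists xi : ray X,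
      ray_end xi = u /\ unbounded_below_along f xi.
    have [l -> [xi [xi_u [a fa]]]] := slopeP u; rewrite lte_fin => l0.
    exists xi; split=> //; apply: (@linear_descent_unbounded _ _ _ _ a (- l)).
      by rewrite oppr_gt0.
    by move=> t t0; rewrite mulNr opprK; exact: fa.
  move=> /unb[xi [<- uxi]] /unb[zeta [<- uzeta]].
  exact: (unbounded_below_ray_end X_hyperbolic L_gt0 f_lipschitz f_convex
    delta_ge0 uxi uzeta).
have [v v0] : exists v : boundary X, (asymptotic_slope f v < 0)%E.
  have : (ereal_inf (range (asymptotic_slope f)) < 0)%E by rewrite -oppe_gt0.
  by move=> /ereal_inf_lt[_ [v _ <-] v0]; exists v.
have [l vl [zeta [zeta_v [a fa]]]] := slopeP v.
have l0 : l < 0 by rewrite -lte_fin -vl.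
have alphaE : alpha = - l.
  (* The infimum is attained at v: every other boundary point has nonnegative slope. *)
  suff infE : ereal_inf (range (asymptotic_slope f)) = l%:E.
    by rewrite /alpha /descent_rate infE.
  apply/eqP; rewrite eq_le; apply/andP; split.
    by rewrite -vl; apply: ereal_inf_lbound; exists v.
  apply: le_ereal_inf_tmp => _ [w _ <-].
  have [w0|w0] := ltP (asymptotic_slope f w) 0%E.
    by rewrite (slope_end w v)// vl.
  by apply: le_trans w0; rewrite lee_fin ltW.
have alpha_gt0 : 0 < alpha by rewrite alphaE oppr_gt0.
have {}fa t : 0 <= t -> f (zeta t) <= a - alpha * t.
  by rewrite alphaE mulNr opprK; exact: fa.
(* Otherwise f would fall along zeta faster than L allows; the time below makes (alpha - L) t exceed
   a - f (zeta 0). *)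
have alpha_le : alpha <= L.
  rewrite leNgt; apply/negP => La; pose b := f (zeta 0) - a.
  have t0 : 0 <= (`|a - f (zeta 0)| + 1) / (alpha - L).
    by apply: divr_ge0; [rewrite addr_ge0|lra].
  have := fa _ t0; have := lipschitz_le f_lipschitz (zeta 0)
    (zeta ((`|a - f (zeta 0)| + 1) / (alpha - L))).
  rewrite ray_isometry// sub0r normrN (ger0_norm t0).
  set t := _ / _; have : (alpha - L) * t = `|a - f (zeta 0)| + 1.
    by rewrite mulrC divfK// gt_eqF// subr_gt0.
  have := ler_norm (a - f (zeta 0)); lra.
have unbounded_end (xi : ray X) : unbounded_below_along f xi -> ray_end xi = v.
  move=> uxi; rewrite -zeta_v.
  apply: (unbounded_below_ray_end X_hyperbolic L_gt0 f_lipschitz f_convex) => //.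
  exact: linear_descent_unbounded alpha_gt0 fa.
exists v; split.
- by split=> // w; exact: slope_end.
- move=> x0 x curve p.
  exact: (gradient_curve_cvg L_gt0 f_lipschitz f_convex tau_gt0 alpha_gt0 fa p
    X_proper curve unbounded_end).
- move=> x0 x curve xi _ _ k t k0 _ fxi.
  apply: sqrt_bound_le => //; first by rewrite alpha_gt0.
  + by rewrite ler1n.
  + exact: gromov_product_ge0.
  (* At level f (x k), the total drop f x0 - f (x k) >= k alpha^2 tau / 2 bounds the Gromov product
     from below. *)
  have := sublevel_gromov_product X_hyperbolic L_gt0 f_lipschitz f_convex x0
    fxi (lexx _).
  apply: le_trans.
  by have := gradient_curve_descent f_convex tau_gt0 alpha_gt0 fa k curve; lra.
Qed.
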